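(* Let $F$ be a semi-Weibull($p,\alpha$) distribution function, where $0<p<1$ and $\alpha>0$. Then: (1) $F$ is $N$-max stable (with some constant $c$) if and only if $N$ has the Sibuya($p$) law. (2) $F$ is $N$-min stable (with some constant $c$) if and only if $N$ is degenerate at $1/p$, where $1/p>1$ is an integer. In both cases the constant $c$ satisfies $c^\alpha=p$.
   Context: Let $X>0$ be a continuous random variable with distribution function $F$, put $R(x)=1-F(x)$, and let $N>0$ be an integer-valued random variable independent of $X$ with probability generating function $Q(s)$. $F$ is called maximum stable with respect to $N$ ($N$-max stable) if $Q[F(x)]=F(cx)$ for all $x>0$ and some $c>0$. $F$ is called minimum stable with respect to $N$ ($N$-min stable) if $Q[R(cx)]=R(x)$ for all $x>0$ and some $c>0$. In both definitions $c\in(0,1)$, and the $c$ in the claim is the constant in the relevant definition. The distribution function $F$ is semi-Weibull($p,\alpha$) if $F(x)=1-e^{-\psi(x)}$ for $x>0$, where $\psi$ satisfies $\psi(x)=\psi(p^{1/\alpha}x)/p$ for all $x>0$, with $0<p<1$ and $\alpha>0$. The Sibuya($v$) law, $0<v<1$, is the law with probability generating function $Q(s)=1-(1-s)^v$. ''$N$ is degenerate at $m$'' means $P(N=m)=1$.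
   Formalization: The ''only if'' parts assume the stability constant satisfies c^α=p (with arbitrary c they fail, e.g. F exponential, p=1/2, N Sibuya(1/4) or N=4, c=1/4); conversely, if N has the stated law, every stability constant is shown to satisfy c^α=p. *)

(* Defs.v *)
From mathcomp Require Import all_boot all_order all_algebra.
From mathcomp Require Import all_classical all_reals all_analysis.

Set Implicit Arguments.
Unset Strict Implicit.
Unset Printing Implicit Defensive.

Import Order.TTheory GRing.Theory Num.Theory.
Import numFieldNormedType.Exports.

Local Open Scope classical_set_scope.
Local Open Scope ring_scope.

(* [cdf] is extended-real valued, but always finite for a probability. *)
Definition distr_fun (d : measure_display) (T : measurableType d)
    (R : realType) (P : probability T R) (X : {RV P >-> R}) (x : R) : R :=
  fine (cdf X x).

Definition survival_fun (d : measure_display) (T : measurableType d)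
    (R : realType) (P : probability T R) (X : {RV P >-> R}) (x : R) : R :=
  1 - distr_fun X x.

(* Meaningful for s in [0, 1], where the expectation is finite; it is only
   used there. *)
Definition pgf (d : measure_display) (T : measurableType d)
    (R : realType) (P : probability T R) (N : {RV P >-> nat}) (s : R) : R :=
  fine 'E_P[fun t => s ^+ N t].

Definition independent_RVs (d d1 d2 : measure_display)
    (T : measurableType d) (T1 : measurableType d1) (T2 : measurableType d2)
    (R : realType) (P : probability T R)
    (X : {RV P >-> T1}) (Y : {RV P >-> T2}) : Prop :=
  forall (A : set T1) (B : set T2), measurable A -> measurable B ->
    P (X @^-1` A `&` Y @^-1` B) = (P (X @^-1` A) * P (Y @^-1` B))%E.

Definition max_stable_with (d : measure_display) (T : measurableType d)
    (R : realType) (P : probability T R)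
    (X : {RV P >-> R}) (N : {RV P >-> nat}) (c : R) : Prop :=
  0 < c < 1 /\
  forall x : R, 0 < x -> pgf N (distr_fun X x) = distr_fun X (c * x).

Definition min_stable_with (d : measure_display) (T : measurableType d)
    (R : realType) (P : probability T R)
    (X : {RV P >-> R}) (N : {RV P >-> nat}) (c : R) : Prop :=
  0 < c < 1 /\
  forall x : R, 0 < x -> pgf N (survival_fun X (c * x)) = survival_fun X x.

Definition semi_Weibull (R : realType) (p alpha : R) (F : R -> R) : Prop :=
  [/\ 0 < p < 1, 0 < alpha &
    exists psi : R -> R,
      (forall x : R, 0 < x -> F x = 1 - expR (- psi x)) /\
      (forall x : R, 0 < x -> psi x = psi (p `^ alpha^-1 * x) / p)].

Definition Sibuya (d : measure_display) (T : measurableType d)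
    (R : realType) (P : probability T R) (N : {RV P >-> nat}) (v : R) : Prop :=
  0 < v < 1 /\ forall s : R, 0 <= s <= 1 -> pgf N s = 1 - (1 - s) `^ v.

Definition degenerate_at (d : measure_display) (T : measurableType d)
    (R : realType) (P : probability T R) (N : {RV P >-> nat}) (m : nat)
    : Prop :=
  P [set t | N t = m] = 1%E.

(* Main.v *)
Require Import Defs.
From mathcomp Require Import all_boot all_order all_algebra.
From mathcomp Require Import all_classical all_reals all_analysis.
From mathcomp Require Import measurable_realfun.

Import Order.TTheory GRing.Theory Num.Theory.
Import numFieldNormedType.Exports.

Local Open Scope classical_set_scope.
Local Open Scope ring_scope.

(* Write R = 1 - F and q = p `^ alpha^-1; the semi-Weibull property says
   R (q x) = R x `^ p.  Since F is continuous with F 0 = 0, it takes every value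
   of (0, 1) on the positive half-line, so stability with constant q determines
   the pgf Q of N on (0, 1): Q s = 1 - (1 - s) `^ p in the max case, and
   Q s = s `^ p^-1 in the min case, which forces N to be degenerate.
   Conversely, either law of N gives F (c x) = F (q x) for all x > 0 when c is a
   stability constant; if c <> q, then F would be invariant under a contraction,
   hence equal to F 0 by continuity at 0. *)

Lemma one_powR (R : realType) (x : R) : 1 `^ x = 1.
Proof. by rewrite powR1. Qed.

(** * Functions invariant under a dilation *)

(** Iterating the invariance gives [F (r ^+ n * x) = F x], and [r ^+ n * x] tends to 0. *)
Lemma contraction_invariant_cst (R : realType) (F : R -> R) (r x : R) :
  {for 0, continuous F} -> 0 < r < 1 ->
  (forall y, 0 < y -> F (r * y) = F y) -> 0 < x -> F x = F 0.
Proof.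
move=> F0 /andP[r0 r1] Fr x0.
have Fn n : F (r ^+ n * x) = F x.
  elim: n => [|n IHn]; first by rewrite expr0 mul1r.
  by rewrite exprS -mulrA Fr ?IHn// mulr_gt0// exprn_gt0.
have rx : (fun n => r ^+ n * x) @ \oo --> (0 : R).
  rewrite -[X in _ --> X](mul0r x); apply: cvgMr_tmp.
  by apply: cvg_expr; rewrite gtr0_norm.
have Frx : (fun n => F (r ^+ n * x)) @ \oo --> F 0.
  exact: (@continuous_cvg _ _ _ _ _ _ F _ F0 rx).
have {}Fn : (fun n => F (r ^+ n * x)) = cst (F x) by exact/funext.
by move: Frx; rewrite Fn => /cvg_lim <- //; rewrite lim_cst.
Qed.

(** If [a < b], substituting [y / b] for the argument makes [F] invariant under the contraction
    [a / b], hence constant on the positive half-line. This identifies the stability constant. *)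
Lemma eq_dilation_factor (R : realType) (F : R -> R) (a b : R) :
  {for 0, continuous F} -> 0 < a -> 0 < b ->
  (exists2 x, 0 < x & F x != F 0) ->
  (forall x, 0 < x -> F (a * x) = F (b * x)) -> a = b.
Proof.
move=> F0 + + [x x0 Fx]; wlog ab : a b / a <= b.
  move=> H a0 b0 ab; have [|/ltW] := leP a b => [le|le]; first exact: H.
  by apply/esym/H => // y y0; rewrite ab.
move=> a0 b0 Fab; apply/eqP/negPn/negP => neq.
have ltab : a < b by rewrite lt_neqAle neq.
move/eqP: Fx; apply; apply: (@contraction_invariant_cst _ _ (a / b)) => //.
  by rewrite divr_gt0//= ltr_pdivrMr// mul1r.
move=> y y0; rewrite -mulrA Fab ?mulr_gt0 ?invr_gt0//.
by rewrite mulrA divff ?mul1r// gt_eqF.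
Qed.

(** * Distribution function of a positive random variable *)

Lemma distr_fun_ge0 (d : measure_display) (T : measurableType d)
    (R : realType) (P : probability T R) (X : {RV P >-> R}) (x : R) :
  0 <= distr_fun X x.
Proof. exact/fine_ge0/cdf_ge0. Qed.

Lemma distr_fun_le1 (d : measure_display) (T : measurableType d)
    (R : realType) (P : probability T R) (X : {RV P >-> R}) (x : R) :
  distr_fun X x <= 1.
Proof.
by rewrite /distr_fun -lee_fin fineK ?fin_num_measure//; exact: cdf_le1.
Qed.

Lemma distr_fun0 (d : measure_display) (T : measurableType d)
    (R : realType) (P : probability T R) (X : {RV P >-> R}) :
  (\forall t \ae P, 0 < X t) -> distr_fun X 0 = 0.
Proof.
move=> [A [mA PA sA]]; rewrite /distr_fun /cdf/= /distribution /pushforward.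
rewrite (_ : P _ = 0%E)//; apply: (subset_measure0 _ _ _ PA) => //.
  by rewrite -[X in measurable X]setTI; exact: measurable_funPT.
by move=> t /=; rewrite in_itv/= => Xt; apply: sA => /=; rewrite ltNge Xt.
Qed.

Lemma cvg_distr_funy (d : measure_display) (T : measurableType d)
    (R : realType) (P : probability T R) (X : {RV P >-> R}) :
  distr_fun X @ +oo --> (1 : R).
Proof. exact/fine_cvg/cvg_cdfy1. Qed.

(** Intermediate values between 0, where the function vanishes, and a point where it exceeds [s],
    which exists because the limit at infinity is 1. The solution is not 0 since [s > 0]. *)
Lemma distr_fun_onto (d : measure_display) (T : measurableType d)
    (R : realType) (P : probability T R) (X : {RV P >-> R}) (s : R) :
  (\forall t \ae P, 0 < X t) -> continuous (distr_fun X) -> 0 < s < 1 ->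
  exists2 x, 0 < x & distr_fun X x = s.
Proof.
move=> X0 Xc /andP[s0 s1]; have F0 := distr_fun0 _ _ _ _ _ X0.
have [b [b0 Fb]] : exists b : R, 0 < b /\ s < distr_fun X b.
  have : \forall b \near +oo, 0 < b /\ s < distr_fun X b.
    near=> b; split; first by near: b; exact: nbhs_pinfty_gt.
    near: b; apply: (cvgr_gt (1 : R)); [exact: cvg_distr_funy | exact: s1].
  by move=> /filter_ex.
have [|||x xb Fx] := @IVT R (distr_fun X) 0 b s.
- exact: ltW.
- exact: continuous_subspaceT.
- by rewrite F0 minElt maxElt (lt_trans s0 Fb)/= !ltW.
exists x => //; move: xb; rewrite in_itv/= => /andP[]; rewrite le_eqVlt.
by move=> /predU1P[x0|//]; move: Fx s0; rewrite -x0 F0 => <-; rewrite ltxx.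
Unshelve. all: by end_near. Qed.

(** * Generating functions on the unit interval *)

Lemma measurable_expr_RV (d : measure_display) (T : measurableType d)
    (R : realType) (P : probability T R) (N : {RV P >-> nat}) (s : R) :
  measurable_fun setT (fun t => (s ^+ N t)%:E).
Proof.
apply/measurable_EFinP.
exact: (@measurableT_comp _ _ _ _ _ _ (fun n => s ^+ n)).
Qed.

Lemma pgf_integrable (d : measure_display) (T : measurableType d)
    (R : realType) (P : probability T R) (N : {RV P >-> nat}) (s : R) :
  0 <= s <= 1 -> P.-integrable setT (fun t => (s ^+ N t)%:E).
Proof.
move=> /andP[s0 s1].
apply: (@le_integrable _ _ _ _ _ measurableT _ (EFin \o cst (1 : R))).
- exact: measurable_expr_RV.
- move=> t _ /=; rewrite lee_fin ger0_norm ?exprn_ge0// normr1.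
  exact: exprn_ile1.
- exact: finite_measure_integrable_cst.
Qed.

Lemma pgfE (d : measure_display) (T : measurableType d)
    (R : realType) (P : probability T R) (N : {RV P >-> nat}) (s : R) :
  0 <= s <= 1 -> (\int[P]_t (s ^+ N t)%:E = (pgf N s)%:E)%E.
Proof.
move=> s01; rewrite /pgf unlock fineK//; apply: integrable_fin_num => //.
exact: pgf_integrable.
Qed.

Lemma pgf_degenerate (d : measure_display) (T : measurableType d)
    (R : realType) (P : probability T R) (N : {RV P >-> nat}) (m : nat)
    (s : R) :
  (\forall t \ae P, N t = m) -> pgf N s = s ^+ m.
Proof.
move=> Nm; rewrite /pgf unlock (ae_eq_integral (cst (s ^+ m)%:E))//.
- by rewrite integral_cst//= probability_setT mule1.
- exact: measurable_expr_RV.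
- by apply: filterS Nm => t /= -> _.
Qed.

(** Since [0 ^+ 0 = 1], the value at 0 is the probability of [N = 0], which positivity of [N] makes
    zero. *)
Lemma pgf0 (d : measure_display) (T : measurableType d)
    (R : realType) (P : probability T R) (N : {RV P >-> nat}) :
  (\forall t \ae P, (0 < N t)%N) -> pgf N 0 = 0.
Proof.
move=> N0; rewrite /pgf unlock (ae_eq_integral (cst 0%E))//.
- by rewrite integral0.
- exact: measurable_expr_RV.
- by apply: filterS N0 => t /= + _; rewrite lt0n expr0n => /negbTE ->.
Qed.

Lemma pgf1 (d : measure_display) (T : measurableType d)
    (R : realType) (P : probability T R) (N : {RV P >-> nat}) :
  pgf N 1 = 1.
Proof.
rewrite /pgf; under eq_fun do rewrite expr1n.
by rewrite expectation_cst.
Qed.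

Lemma measurable_RV_eq (d : measure_display) (T : measurableType d)
    (R : realType) (P : probability T R) (N : {RV P >-> nat}) (k : nat) :
  measurable [set t | N t = k].
Proof.
by rewrite -[X in measurable X]setTI; exact: (measurable_funPT N _ [set k]).
Qed.

(** The left side is the integral of [s ^+ N t] over the event [N t = k] alone, and the integrand is
    nonnegative elsewhere. *)
Lemma le_prob_pgf (d : measure_display) (T : measurableType d)
    (R : realType) (P : probability T R) (N : {RV P >-> nat}) (k : nat)
    (s : R) :
  0 <= s <= 1 -> (P [set t | N t = k] * (s ^+ k)%:E <= (pgf N s)%:E)%E.
Proof.
move=> s01; have /andP[s0 s1] := s01; rewrite -pgfE// muleC.
rewrite -integral_cst; last exact: measurable_RV_eq.
rewrite (_ : (\int[P]_(x in [set t | N t = k]) cst (s ^+ k)%:E x =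
  \int[P]_(x in [set t | N t = k]) (s ^+ N x)%:E)%E); last first.
  by apply: eq_integral => t; rewrite inE/= => ->.
apply: ge0_subset_integral => //.
- exact: measurable_RV_eq.
- exact: measurable_int (pgf_integrable _ _ _ _ _ _ s01).
- by move=> t _; rewrite lee_fin exprn_ge0.
Qed.

Lemma degenerate_atP (d : measure_display) (T : measurableType d)
    (R : realType) (P : probability T R) (N : {RV P >-> nat}) (m : nat) :
  degenerate_at N m <-> \forall t \ae P, N t = m.
Proof.
have mE := measurable_RV_eq _ _ _ _ N m.
have -> : (\forall t \ae P, N t = m) <-> P (~` [set t | N t = m]) = 0%E.
  exact: (negligibleP _ (measurableC mE)).
rewrite /degenerate_at probability_setC//; split=> [->|].
  by rewrite subee.
by rewrite -(fineK (fin_num_measure P _ mE)) -EFinB => -[/subr0_eq] <-.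
Qed.

(* Letting s tend to 0 in [P(N = k) s^k <= s^a] shows that N >= a almost
   surely; then s^a - s^N is nonnegative with zero expectation. *)
Lemma pgf_powR_degenerate (d : measure_display) (T : measurableType d)
    (R : realType) (P : probability T R) (N : {RV P >-> nat}) (a : R) :
  (forall s : R, 0 < s < 1 -> pgf N s = s `^ a) ->
  exists2 m : nat, m%:R = a & degenerate_at N m.
Proof.
move=> Na.
have N_ge : \forall t \ae P, a <= (N t)%:R.
  (* There are countably many [k], so each value below [a] can be excluded separately. *)
  suff : \forall t \ae P, forall k : nat, k%:R < a -> N t != k.
    apply: filterS => t Nt; rewrite leNgt; apply/negP => /Nt.
    by rewrite eqxx.
  apply: ae_foralln => k; have [ka|ka] := ltP k%:R a; last exact: aeW.
  suff Pk : P [set t | N t = k] = 0%E.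
    exists [set t | N t = k]; split=> //; first exact: measurable_RV_eq.
    by move=> t /= /not_implyP[_ /negP/negPn/eqP].
  have mk := measurable_RV_eq _ _ _ _ N k.
  rewrite -(fineK (fin_num_measure P _ mk)).
  set w := fine _; have wE : P [set t | N t = k] = w%:E.
    by rewrite fineK// fin_num_measure.
  have w0 : 0 <= w by exact: fine_ge0.
  have w1 : w <= 1 by rewrite -lee_fin -wE probability_le1.
  congr EFin; apply/eqP; move: w0; rewrite le_eqVlt => /predU1P[/esym/eqP//|w0].
  have b0 : 0 < a - k%:R by rewrite subr_gt0.
  pose s := (w / 2) `^ (a - k%:R)^-1.
  have w20 : 0 < w / 2 by exact: divr_gt0.
  have s0 : 0 < s by exact: powR_gt0.
  have s1 : s < 1.
    rewrite -[ltRHS](one_powR _ (a - k%:R)^-1) gt0_ltr_powR ?invr_gt0//.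
    - by rewrite nnegrE ltW.
    - by rewrite nnegrE.
    - by rewrite ltr_pdivrMr// mul1r (le_lt_trans w1)// ltr1n.
  have s01 : 0 < s < 1 by rewrite s0.
  have s01' : 0 <= s <= 1 by rewrite !ltW.
  have := le_prob_pgf _ _ _ P N k s s01'; rewrite wE -EFinM lee_fin Na//.
  rewrite -[in leRHS](subrK k%:R a) powRD; last first.
    by apply/implyP => _; rewrite gt_eqF.
  rewrite powR_mulrn ?(ltW s0)// ler_pM2r ?exprn_gt0//.
  rewrite /s -powRrM mulVf ?gt_eqF// powRr1 ?(ltW w20)//.
  by rewrite ler_pdivlMr// ger_pMr// lern1.
(* One point of (0, 1) suffices, because the powers of [s] are strictly decreasing in the
   exponent. *)
pose s : R := 2^-1.
have s01 : 0 < s < 1 by rewrite invr_gt0 ltr0n/= invf_lt1 ?ltr1n.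
have /andP[s0 s1] := s01.
have s01' : 0 <= s <= 1 by rewrite !ltW.
have iN := pgf_integrable _ _ _ P N _ s01'.
have ic : P.-integrable setT (EFin \o cst (s `^ a)).
  exact: finite_measure_integrable_cst.
have D0 : (\int[P]_t ((s `^ a)%:E - (s ^+ N t)%:E) = 0)%E.
  rewrite integralB_EFin//= integral_cst//= probability_setT mule1.
  by rewrite pgfE// Na// subee.
have Dge : \forall t \ae P, s ^+ N t <= s `^ a.
  apply: filterS N_ge => t aN; rewrite -powR_mulrn ?(ltW s0)//.
  by apply: ger_powR => //; rewrite s0 ltW.
have mD : measurable_fun setT (fun t => ((s `^ a)%:E - (s ^+ N t)%:E)%E).
  by apply: emeasurable_funB; [exact: measurable_int ic|
                               exact: measurable_int iN].
have Neq : \forall t \ae P, s ^+ N t = s `^ a.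
  have /(ae_eq_integral_abs P measurableT mD) :
      (\int[P]_t `|(s `^ a)%:E - (s ^+ N t)%:E| = 0)%E.
    rewrite -[RHS]D0; apply: ae_eq_integral => //.
      exact: measurableT_comp.
    apply: filterS Dge => t st _ /=.
    by rewrite ger0_norm// subr_ge0.
  by apply: filterS => t /= /(_ I) [/subr0_eq].
have Na_eq : \forall t \ae P, (N t)%:R = a.
  apply: filterS Neq => t; rewrite -powR_mulrn ?(ltW s0)// => /(congr1 (@ln R)).
  by rewrite !ln_powR => /mulIf; apply; rewrite lt_eqF// ln_lt0.
(* An almost sure event of a probability space is nonempty; the value of [N] at one of its points
   shows that [a] is an integer. *)
have [t0 Nt0] : exists t, (N t)%:R = a.
  have PT0 : (0 < P setT)%E by rewrite probability_setT.
  exact: (@filter_ex _ _ (ae_properfilter_algebraOfSetsType PT0) _ Na_eq).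
exists (N t0) => //; apply/degenerate_atP.
by apply: filterS Na_eq => t; rewrite -Nt0 => /eqP; rewrite eqr_nat => /eqP.
Qed.

(** * The semi-Weibull equation and the stability theorem *)

(** With [q] the dilation factor, [psi (q * x) = p * psi x]; the factor [p] leaves the exponential
    as a power. *)
Lemma semi_Weibull_survival (d : measure_display) (T : measurableType d)
    (R : realType) (P : probability T R) (X : {RV P >-> R}) (p alpha x : R) :
  semi_Weibull p alpha (distr_fun X) -> 0 < x ->
  survival_fun X (p `^ alpha^-1 * x) = survival_fun X x `^ p.
Proof.
move=> [/andP[p0 p1] a0 [psi [FE psiE]]] x0; rewrite /survival_fun.
rewrite !FE ?mulr_gt0 ?powR_gt0// (psiE x x0) !subKr.
by rewrite -expRM mulNr divfK// gt_eqF.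
Qed.

Theorem mainTheorem5 (d : measure_display) (T : measurableType d)
    (R : realType) (P : probability T R)
    (X : {RV P >-> R}) (N : {RV P >-> nat}) (p alpha : R)
    (hX : \forall t \ae P, 0 < X t)
    (hXc : continuous (distr_fun X))
    (hN : \forall t \ae P, (0 < N t)%N)
    (hind : independent_RVs X N)
    (hp : 0 < p < 1) (halpha : 0 < alpha)
    (hF : semi_Weibull p alpha (distr_fun X)) :
  [/\ (exists c : R, max_stable_with X N c /\ c `^ alpha = p) <-> Sibuya N p,
      (exists c : R, min_stable_with X N c /\ c `^ alpha = p) <->
        (exists m : nat, [/\ (1 < m)%N, m%:R = p^-1 & degenerate_at N m]),
      (forall c : R, max_stable_with X N c -> Sibuya N p -> c `^ alpha = p) &
      (forall (c : R) (m : nat), min_stable_with X N c ->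
        m%:R = p^-1 -> degenerate_at N m -> c `^ alpha = p)].
Proof.
have /andP[p0 p1] := hp.
pose q := p `^ alpha^-1.
have q0 : 0 < q by rewrite powR_gt0.
have q1 : q < 1.
  rewrite -[ltRHS](one_powR _ alpha^-1) gt0_ltr_powR ?invr_gt0 ?nnegrE//.
  exact: ltW.
have qa : q `^ alpha = p by rewrite /q -powRrM mulVf ?gt_eqF// powRr1// ltW.
have eq_q c : 0 < c -> c `^ alpha = p -> c = q.
  by move=> c0 ca; rewrite /q -ca -powRrM mulfV ?gt_eqF// powRr1// ltW.
have Rq x : 0 < x -> survival_fun X (q * x) = survival_fun X x `^ p.
  exact: semi_Weibull_survival.
have FR x : distr_fun X x = 1 - survival_fun X x by rewrite subKr.
have R_ge0 x : 0 <= survival_fun X x by rewrite subr_ge0 distr_fun_le1.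
have R_le1 x : survival_fun X x <= 1 by rewrite gerBl distr_fun_ge0.
have F_onto s : 0 < s < 1 -> exists2 x, 0 < x & distr_fun X x = s.
  exact: distr_fun_onto.
(* A point where the distribution function equals 1/2 shows that it is not constantly 0, its value
   at 0. *)
have q_uniq c : 0 < c -> (forall x, 0 < x ->
    distr_fun X (c * x) = distr_fun X (q * x)) -> c `^ alpha = p.
  move=> c0 cq; rewrite -qa; congr (_ `^ _).
  apply: (@eq_dilation_factor _ (distr_fun X)) => //; first exact: hXc.
  have [|x x0 Fx] := F_onto 2^-1.
    by rewrite invr_gt0 ltr0n/= invf_lt1 ?ltr1n.
  by exists x => //; rewrite Fx distr_fun0// gt_eqF// invr_gt0.
split.
- split=> [[c [[/andP[c0 c1] maxX] ca]]|[_ SN]].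
    (* The endpoints 0 and 1 need not be values of [distr_fun X] at positive points, so they are
       treated directly. *)
    split=> // s /andP[]; rewrite le_eqVlt => /predU1P[<- _|s0].
      by rewrite pgf0// subr0 powR1 subrr.
    rewrite le_eqVlt => /predU1P[->|s1].
      by rewrite pgf1 subrr powR0 ?subr0// gt_eqF.
    have [|x x0 <-] := F_onto s; first by rewrite s0.
    by rewrite maxX// (eq_q c)// FR Rq.
  exists q; split=> //; split=> [|x x0]; first by rewrite q0.
  by rewrite SN ?distr_fun_ge0 ?distr_fun_le1// (FR (q * x)) Rq.
- split=> [[c [[/andP[c0 c1] minX] ca]]|[m [m1 mp Nm]]].
    have [s /andP[s0 s1]|m mp Nm] := @pgf_powR_degenerate _ _ _ P N p^-1.
      pose u := s `^ p^-1.
      have u0 : 0 < u by rewrite powR_gt0.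
      have u1 : u < 1.
        rewrite -[ltRHS](one_powR _ p^-1) gt0_ltr_powR ?invr_gt0 ?nnegrE//.
        exact: ltW.
      have [|x x0 Fx] := F_onto (1 - u).
        by rewrite subr_gt0 u1/= gtrBl.
      have Rx : survival_fun X x = u by rewrite /survival_fun Fx subKr.
      have := minX x x0; rewrite (eq_q c)// Rq// Rx /u -powRrM mulVf ?gt_eqF//.
      by rewrite powRr1// ltW.
    exists m; split=> //.
    by rewrite -(ltr_nat R) mp invf_gt1.
  exists q; split=> //; split=> [|x x0]; first by rewrite q0.
  rewrite (pgf_degenerate _ _ _ _ _ m); last exact/degenerate_atP.
  rewrite Rq// -powR_mulrn ?powR_ge0// -powRrM mp mulfV ?gt_eqF//.
  by rewrite powRr1.
- move=> c [/andP[c0 c1] maxX] [_ SN]; apply: q_uniq => // x x0.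
  rewrite -maxX// SN ?distr_fun_ge0 ?distr_fun_le1//.
  by rewrite (FR (q * x)) Rq.
- move=> c m [/andP[c0 c1] minX] mp /degenerate_atP Nm.
  apply: q_uniq => // x x0.
  (* Stability says that the survival value at [c * x], raised to the power [m], is the one at [x];
     since [m * p = 1], taking the power [p] gives the survival value at [q * x]. *)
  have := minX x x0; rewrite (pgf_degenerate _ _ _ _ _ m)// => Rc.
  rewrite !FR; congr (_ - _); rewrite Rq// -Rc -powR_mulrn//.
  by rewrite -powRrM mp mulVf ?gt_eqF// powRr1.
Qed.
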